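(* Let $T:A^{\mathbb Z}\to A^{\mathbb Z}$ be the Pacman cellular automaton. Then $(A^{\mathbb Z},T)$ has no equicontinuity points (hence it is not almost equicontinuous). However, $(A^{\mathbb Z},T)$ is almost mean equicontinuous.
   Context: Let $A=\{\mathtt 0,\mathtt 1,\mathtt G,\mathtt K,\mathtt P,\mathtt D\}$ be an alphabet of six distinct symbols ($\mathtt 0$ empty space, $\mathtt 1$ empty door, $\mathtt G$ ghost, $\mathtt K$ keymaster ghost, $\mathtt P$ pacman, $\mathtt D$ door with ghost). $Tx_i$ denotes the $i$-th coordinate of $Tx$. The Pacman cellular automaton $T:A^{\mathbb Z}\to A^{\mathbb Z}$ is defined, for $x\in A^{\mathbb Z}$, $i\in\mathbb Z$, with $a=x_{i-1}$, $b=x_i$, $c=x_{i+1}$, by: - $Tx_i=\mathtt 0$ if $\big(a\in\{\mathtt 0,\mathtt G,\mathtt K\}$ and $[(b\in\{\mathtt 0,\mathtt G,\mathtt K\}$ and $c\in\{\mathtt 0,\mathtt 1,\mathtt P\})$ or $(b=\mathtt P$ and $c\notin\{\mathtt 1,\mathtt D\})]\big)$ or $\big(a\in\{\mathtt 1,\mathtt D\}$ and $[(b\in\{\mathtt 0,\mathtt K\}$ and $c\in\{\mathtt 0,\mathtt 1,\mathtt P\})$ or $(b=\mathtt P$ and $c\notin\{\mathtt 1,\mathtt D\})]\big)$; - $Tx_i=\mathtt 1$ if $b\in\{\mathtt 1,\mathtt D\}$ and $c\notin\{\mathtt K,\mathtt D\}$; - $Tx_i=\mathtt G$ if $(a\in\{\mathtt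 0,\mathtt G,\mathtt K\}$, $b\in\{\mathtt 0,\mathtt G,\mathtt K\}$, $c\in\{\mathtt G,\mathtt D\})$ or $(a\in\{\mathtt 1,\mathtt D\}$, $b\in\{\mathtt 0,\mathtt K\}$, $c=\mathtt D)$; - $Tx_i=\mathtt K$ if $\big(c=\mathtt K$ and $[(a\in\{\mathtt 0,\mathtt G,\mathtt K\}$ and $b\in\{\mathtt 0,\mathtt G,\mathtt K\})$ or $(a\in\{\mathtt 1,\mathtt D\}$ and $b\in\{\mathtt 0,\mathtt K\})]\big)$ or $(a=\mathtt P$, $b\notin\{\mathtt 1,\mathtt D\}$, $c\in\{\mathtt 1,\mathtt D\})$ or $(b=\mathtt P$ and $c\in\{\mathtt 1,\mathtt D\})$; - $Tx_i=\mathtt P$ if $\big(a\in\{\mathtt 1,\mathtt D\}$ and $[(b\in\{\mathtt 0,\mathtt K\}$ and $c=\mathtt G)$ or $b=\mathtt G]\big)$ or $(a=\mathtt P$ and $b,c\notin\{\mathtt 1,\mathtt D\})$; - $Tx_i=\mathtt D$ if $b\in\{\mathtt 1,\mathtt D\}$ and $c\in\{\mathtt K,\mathtt D\}$. The metric on $A^{\mathbb Z}$ is $d(x,y)=2^{-i}$ with $i=\min\{|j|:x_j\ne y_j\}$ if $x\neq y$, and $d(x,x)=0$. A point $x$ is an equicontinuity point if for every $\varepsilon>0$ there is $\delta>0$ such that $d(T^nx,T^ny)<\varepsilon$ for all $y\in B_\delta(x)$ and $n\ge0$. A point $x$ is a mean equicontinuity point if for every $\varepsilon>0$ there is $\delta>0$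 such that $d(x,y)<\delta$ implies $\limsup_{n\to\infty}\frac{1}{n+1}\sum_{i=0}^{n}d(T^ix,T^iy)\le\varepsilon$. A set is residual if it is the intersection of countably many dense open sets. The system is almost equicontinuous (resp. almost mean equicontinuous) if its set of equicontinuity points (resp. mean equicontinuity points) is residual. *)

(* Defs.v *)
From HB Require Import structures.
From mathcomp Require Import all_boot all_order all_algebra.
From mathcomp Require Import all_classical all_reals all_analysis.

Set Implicit Arguments.
Unset Strict Implicit.
Unset Printing Implicit Defensive.

Import Order.TTheory GRing.Theory Num.Theory.
Local Open Scope classical_set_scope.
Local Open Scope ring_scope.

(* s0: empty space, s1: empty door, sG: ghost, sK: keymaster ghost,
   sP: pacman, sD: door with ghost. *)
Inductive symbol := s0 | s1 | sG | sK | sP | sD.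

Definition nat_of_symbol (s : symbol) : nat :=
  match s with s0 => 0 | s1 => 1 | sG => 2 | sK => 3 | sP => 4 | sD => 5 end%N.

Definition symbol_of_nat (n : nat) : symbol := nth s0 [:: s0; s1; sG; sK; sP; sD] n.

Lemma nat_of_symbolK : cancel nat_of_symbol symbol_of_nat.
Proof. by case. Qed.

HB.instance Definition _ := Countable.copy symbol (can_type nat_of_symbolK).

Lemma symbol_enumP : Finite.axiom [:: s0; s1; sG; sK; sP; sD].
Proof. by case. Qed.

HB.instance Definition _ := fintype.isFinite.Build symbol symbol_enumP.

(* [becomes s a b c] is the condition for a cell in state [b], with left
   neighbour [a] and right neighbour [c], to take the state [s]. *)
Definition becomes (s a b c : symbol) : bool :=
  match s with
  | s0 =>
      ((a \in [:: s0; sG; sK]) &&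
         (((b \in [:: s0; sG; sK]) && (c \in [:: s0; s1; sP]))
          || ((b == sP) && (c \notin [:: s1; sD]))))
      || ((a \in [:: s1; sD]) &&
         (((b \in [:: s0; sK]) && (c \in [:: s0; s1; sP]))
          || ((b == sP) && (c \notin [:: s1; sD]))))
  | s1 => (b \in [:: s1; sD]) && (c \notin [:: sK; sD])
  | sG =>
      [&& a \in [:: s0; sG; sK], b \in [:: s0; sG; sK] & c \in [:: sG; sD]]
      || [&& a \in [:: s1; sD], b \in [:: s0; sK] & c == sD]
  | sK =>
      [|| (c == sK) &&
            (((a \in [:: s0; sG; sK]) && (b \in [:: s0; sG; sK]))
             || ((a \in [:: s1; sD]) && (b \in [:: s0; sK]))),
          [&& a == sP, b \notin [:: s1; sD] & c \in [:: s1; sD]]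
        | (b == sP) && (c \in [:: s1; sD])]
  | sP =>
      ((a \in [:: s1; sD]) && (((b \in [:: s0; sK]) && (c == sG)) || (b == sG)))
      || [&& a == sP, b \notin [:: s1; sD] & c \notin [:: s1; sD]]
  | sD => (b \in [:: s1; sD]) && (c \in [:: sK; sD])
  end.

Definition pacman_rule (a b c : symbol) : symbol :=
  if becomes s0 a b c then s0
  else if becomes s1 a b c then s1
  else if becomes sG a b c then sG
  else if becomes sK a b c then sK
  else if becomes sP a b c then sP
  else sD.

(* The six conditions are mutually exclusive and exhaustive, so the order of the
   tests and the default value in [pacman_rule] are immaterial. *)
Lemma pacman_ruleE (s a b c : symbol) : (pacman_rule a b c == s) = becomes s a b c.
Proof. by case: s; case: a; case: b; case: c. Qed.

(* The full shift; [R] is only the type in which its metric takes values. *)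
Definition config (R : realType) : Type := int -> symbol.

Section Metric.
Variable R : realType.

Definition differ_at_dist (x y : config R) (n : nat) : bool :=
  `[< exists2 j : int, `|j|%N = n & x j <> y j >].

Lemma neq_differ (x y : config R) : x <> y -> exists n, differ_at_dist x y n.
Proof.
move=> xy; apply: contrapT => nd; apply: xy; apply/funext => j.
apply: contrapT => xyj; apply: nd; exists `|j|%N; apply/asboolP.
by exists j.
Qed.

Definition config_dist (x y : config R) : R :=
  if pselect (x = y) is right xy then 2 ^- ex_minn (neq_differ xy) else 0.

Lemma config_distxx (x : config R) : config_dist x x = 0.
Proof. by rewrite /config_dist; case: pselect. Qed.

Lemma config_dist_eq0 (x y : config R) : config_dist x y = 0 -> x = y.
Proof.
rewrite /config_dist; case: pselect => // xy /eqP.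
by rewrite invr_eq0 expf_eq0 pnatr_eq0 andbF.
Qed.

Lemma config_dist_ltP (x y : config R) (n : nat) :
  (config_dist x y < 2 ^- n) <-> (forall j : int, (`|j| <= n)%N -> x j = y j).
Proof.
rewrite /config_dist; case: pselect => [<-|xy].
  by split=> // _; rewrite invr_gt0 exprn_gt0.
case: ex_minnP => m /asboolP[k km xyk] mmin.
rewrite ltf_pV2 ?posrE ?exprn_gt0// ltr_eXn2l ?ltr1n//; split.
  move=> nm j jn; apply: contrapT => xyj.
  have : (m <= `|j|)%N by apply: mmin; apply/asboolP; exists j.
  by move=> /leq_trans /(_ jn); rewrite leqNgt nm.
by move=> H; rewrite ltnNge -km; apply/negP => /H /xyk.
Qed.

Lemma config_dist_sym (x y : config R) : config_dist x y = config_dist y x.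
Proof.
rewrite /config_dist; case: pselect => [e|xy]; case: pselect => [e'|yx] //.
- by case: yx.
- by case: xy.
congr (_ ^- _); apply: eq_ex_minn => n.
by apply/asboolP/asboolP => -[j jn ne]; exists j => // /esym.
Qed.

Lemma config_dist_triangle (y x z : config R) :
  config_dist x z <= config_dist x y + config_dist y z.
Proof.
have ge0 u v : 0 <= config_dist u v.
  by rewrite /config_dist; case: pselect => // ?; rewrite invr_ge0 exprn_ge0.
suff : (config_dist x z <= config_dist x y) || (config_dist x z <= config_dist y z).
  by case/orP => /le_trans; apply; rewrite ?lerDl ?lerDr.
apply: contraT; rewrite negb_or -!ltNge => /andP[].
rewrite {2 4}/config_dist; case: pselect => [_|xz].
  by move=> /(le_lt_trans (ge0 _ _)); rewrite ltxx.
case: ex_minnP => m /asboolP[k km xzk] _ /config_dist_ltP xy /config_dist_ltP yz.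
by case: xzk; rewrite xy ?km// yz ?km.
Qed.

HB.instance Definition _ := gen_eqMixin (config R).
HB.instance Definition _ := gen_choiceMixin (config R).
HB.instance Definition _ := isMetric.Build R (config R)
  config_distxx config_dist_eq0 config_dist_sym config_dist_triangle.

Definition pacman (x : config R) : config R :=
  fun i => pacman_rule (x (i - 1)) (x i) (x (i + 1)).

End Metric.

Section Dynamics.
Variables (R : realType) (X : metricType R).

Definition equicontinuity_point (T : X -> X) (x : X) : Prop :=
  forall eps : R, 0 < eps -> exists2 delta : R, 0 < delta &
    forall y : X, ball x delta y ->
      forall n : nat, mdist (iter n T x) (iter n T y) < eps.

Definition mean_dist (T : X -> X) (x y : X) (n : nat) : R :=
  n.+1%:R^-1 * \sum_(0 <= i < n.+1) mdist (iter i T x) (iter i T y).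

Definition mean_equicontinuity_point (T : X -> X) (x : X) : Prop :=
  forall eps : R, 0 < eps -> exists2 delta : R, 0 < delta &
    forall y : X, mdist x y < delta ->
      (limn_esup (fun n => (mean_dist T x y n)%:E) <= eps%:E)%E.

(* Equal to, and not merely containing, a countable intersection of dense open
   sets. *)
Definition residual (S : set X) : Prop :=
  exists F : nat -> set X,
    (forall n, open (F n) /\ dense (F n)) /\ S = \bigcap_n F n.

Definition almost_equicontinuous (T : X -> X) : Prop :=
  residual [set x | equicontinuity_point T x].

Definition almost_mean_equicontinuous (T : X -> X) : Prop :=
  residual [set x | mean_equicontinuity_point T x].

End Dynamics.

(* Main.v *)
(** Doors never move, and a cell to the right of a door is not influenced by
    what lies to the left of that door: the half-line starting at a door evolves
    on its own.

    A particle inside a window closed by two doors has only a bounded time to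
    live there: in each room it goes left as a ghost, right as a pacman and left
    again as a keymaster, and then enters the next room on the left. Hence the
    window is empty unless a ghost came through its right door recently.

    Mean equicontinuity: the keymasters leaving a gap of length [L] between two
    doors come from pacmen that crossed the gap, eating every ghost they met, so
    they are at least [L] steps apart, whatever enters the gap from the right.
    With such a gap next to the window, the window is empty except for a
    proportion of times of order [1 / L]. This gives density of the points where
    all orbits starting nearby are eventually [eps]-close in the mean, which is
    an open condition.

    No equicontinuity: enclose the window of [x] between two doors and put a
    single keymaster far to its right. It reaches the window when that is already
    empty, and then crosses the origin, at a time depending on its initial
    position. *)

Require Import Defs.
From mathcomp Require Import all_boot all_order all_algebra.
From mathcomp Require Import all_classical all_reals all_analysis.
From mathcomp Require Import zify lra.

Set Implicit Arguments.
Unset Strict Implicit.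
Unset Printing Implicit Defensive.

Import Order.TTheory GRing.Theory Num.Theory.

Definition is_door (s : symbol) : bool := s \in [:: s1; sD].

Definition occupied (s : symbol) : bool := s \notin [:: s0; s1].

Lemma is_door_rule (a b c : symbol) : is_door (pacman_rule a b c) = is_door b.
Proof. by case: a; case: b; case: c. Qed.

(* A particle only disappears by being eaten, and the eater is next to it. *)
Lemma rule_survival (a b s c d : symbol) : occupied s ->
  [|| occupied (pacman_rule a b s), occupied (pacman_rule b s c)
    | ~~ is_door s && ~~ is_door c && occupied (pacman_rule s c d)].
Proof.
by case: s => //; case: b => //; case: a => //; case: c => //; case: d.
Qed.

(** * Lifetime of particles on a half-line starting at a door *)

Section HalfLine.
Variable c : nat -> nat -> symbol.
Hypothesis left_door : forall t, is_door (c t 0).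
Hypothesis step :
  forall t i, c t.+1 i.+1 = pacman_rule (c t i) (c t i.+1) (c t i.+2).

Lemma is_door_evol (t i : nat) : is_door (c t i) = is_door (c 0 i).
Proof.
case: i => [|i]; first by rewrite !left_door.
by elim: t => // t IH; rewrite step is_door_rule.
Qed.

Section Drain.
Variable n : nat.
Hypothesis door_n : is_door (c 0 n).

Definition doors_before (p : nat) : nat := \sum_(i < p) is_door (c 0 i).

(* A bound on the time a particle of kind [s] at [p] needs to leave through the
   left door: in each room it crosses to the left as a [G], back as a [P], and to
   the left again as a [K]. *)
Definition potential (p : nat) (s : symbol) : nat :=
  3 * n * doors_before p +
  match s with
  | sP => n + (n - p) | sK => p | sG | sD => 2 * n + p | s0 | s1 => 0
  end.

Lemma doors_beforeS (p t : nat) :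
  doors_before p.+1 = doors_before p + is_door (c t p).
Proof. by rewrite /doors_before big_ord_recr /= (is_door_evol t). Qed.

Lemma potential_le (p : nat) (s : symbol) :
  p <= n -> potential p s <= 3 * n * n + 3 * n.
Proof.
move=> pn; have : doors_before p <= n.
  apply: leq_trans pn; rewrite -[leqRHS]card_ord -sum1_card.
  by apply: leq_sum => i _; case: is_door.
move=> /(leq_mul (leqnn (3 * n))); rewrite /potential; case: s; lia.
Qed.

(** Backwards in time, every particle has a source of higher potential in its own or an adjacent
    cell, possibly on the right door [n], never on the left one. *)
Lemma potential_step (t p : nat) : p.+1 < n -> occupied (c t.+1 p.+1) ->
  exists q, [/\ 0 < q <= n, occupied (c t q) &
    potential p.+1 (c t.+1 p.+1) < potential q (c t q)].
Proof.
move=> pn; rewrite step => occ.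
pose new := potential p.+1 (pacman_rule (c t p) (c t p.+1) (c t p.+2)).
suff : [|| [&& 0 < p, occupied (c t p) & new < potential p (c t p)],
    occupied (c t p.+1) && (new < potential p.+1 (c t p.+1)) |
    occupied (c t p.+2) && (new < potential p.+2 (c t p.+2))].
  case/or3P => [/and3P[p0 oq l]|/andP[oq l]|/andP[oq l]].
  - by exists p; split => //; lia.
  - by exists p.+1; split => //; lia.
  - by exists p.+2; split => //; lia.
have p0 : is_door (c t p) || (0 < p).
  by case: posnP => [->|_]; rewrite ?left_door ?orbT.
rewrite /new /potential !(doors_beforeS _ t) !mulnDr.
move: occ p0; case: (c t p); case: (c t p.+1); case: (c t p.+2) => //= _ p0;
  rewrite ?andbT ?andbF /=; lia.
Qed.

Lemma potential_descent (k t p : nat) : 0 < p < n -> occupied (c (t + k) p) ->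
  (exists2 s, t <= s < t + k & c s n = sD) \/
  (exists q, [/\ 0 < q < n, occupied (c t q) &
     potential p (c (t + k) p) + k <= potential q (c t q)]).
Proof.
elim: k p => [|k IH] p pn.
  by rewrite !addn0 => occ; right; exists p.
case: p pn => [//|p] pn; rewrite addnS => /potential_step[]//.
move=> q [/andP[q0]]; rewrite leq_eqVlt => /orP[/eqP -> occ _|qn occ lt].
  left; exists (t + k); first lia.
  have : is_door (c (t + k) n).
    by rewrite is_door_evol.
  by case: (c _ _) occ.
case: (IH q) => //; first by rewrite q0.
  by move=> [s st cs]; left; exists s => //; lia.
by move=> [r [rn or le]]; right; exists r; split => //; lia.
Qed.

(** One more than any potential: a trace back this long must meet door [n]. *)
Definition drain_time : nat := (3 * n * n + 3 * n).+1.

Lemma drain (t p : nat) : 0 < p < n -> drain_time <= t -> occupied (c t p) ->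
  exists2 s, s < t <= s + drain_time & c s n = sD.
Proof.
move=> pn nt; rewrite -(subnK nt).
move=> /potential_descent[]// => [[s st cs]|[q [qn _]]].
  by exists s => //; lia.
have : potential q (c (t - drain_time) q) < drain_time.
  by rewrite ltnS; apply: potential_le; lia.
lia.
Qed.

End Drain.

(** By [rule_survival] a particle has a successor within one cell. This is never on [r], which stays
    empty, nor beyond [n], since from a door it is on that door or to its left. *)
Lemma survival (t r n p : nat) : 0 < r -> is_door (c 0 n) ->
  (forall s, t <= s -> ~~ occupied (c s r)) -> r < p <= n -> occupied (c t p) ->
  forall k, exists2 q, r < q <= n & occupied (c (t + k) q).
Proof.
move=> r0 dn empty rp occ; elim=> [|k [[|[|q]] rq]].
- by exists p; rewrite ?addn0.
- by rewrite ltn0 in rq.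
- by rewrite ltnS leqn0 in rq; move: r0 rq; case: (r).
move=> /(@rule_survival (c (t + k) q) (c (t + k) q.+1) _ (c (t + k) q.+3)
  (c (t + k) q.+4)).
rewrite -!step addnS => /or3P[occ'|occ'|/andP[/andP[nd _] occ']].
- exists q.+1 => //; have [rq'|] := ltnP r q.+1; first lia.
  move=> rq'; have er : q.+1 = r by lia.
  by have := empty (t + k).+1; rewrite -er occ' => /(_ _)/implyP; lia.
- by exists q.+2.
- exists q.+3 => //; have : q.+2 != n.
    by apply: contraNneq nd => ->; rewrite is_door_evol.
  lia.
Qed.

(** * Spacing of the keymasters that leave a gap *)

Section Gap.
Variable L : nat.
Hypothesis L_ge2 : 1 < L.
Hypothesis gap : forall i, 0 < i <= L -> ~~ is_door (c 0 i).
Hypothesis right_door : is_door (c 0 L.+1).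

(** A pacman turns into a keymaster only beside a door on the right; elsewhere a keymaster comes
    from the cell to its right. *)
Lemma keymaster_origin (t i : nat) :
  i < L -> c (t + i) 1 = sK -> c t i.+1 = sK.
Proof.
elim: i t => [|i IH] t iL; first by rewrite addn0.
rewrite addnS -addSn => /IH -/(_ (ltnW iL)).
have := gap (i := i.+2); rewrite -(is_door_evol t) step => /(_ iL).
by case: (c t i.+2); case: (c t i); case: (c t i.+1).
Qed.

(** Pacmen are born only just to the right of a door, so beyond cell 1 they come from the left. *)
Lemma pacman_origin (t i : nat) : i < L -> c (t + i) i.+1 = sP ->
  forall j, j <= i -> c (t + j) j.+1 = sP.
Proof.
elim: i => [|i IH] iL Pi j; first by rewrite leqn0 => /eqP ->.
rewrite leq_eqVlt => /orP[/eqP -> //|]; apply: IH; first exact: ltnW.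
have := gap (i := i.+1); rewrite -(is_door_evol (t + i)) => /(_ (ltnW iL)).
move: Pi; rewrite addnS step.
by case: (c _ i.+1); case: (c _ i.+2); case: (c _ i.+3).
Qed.

(** The rule puts no pacman on [L], just before the right door, so the one turning into this
    keymaster was on [L.-1]. *)
Lemma pacman_before_keymaster (t : nat) : c t.+2 L = sK -> c t.+1 L.-1 = sP.
Proof.
have := right_door; rewrite -(is_door_evol t.+1).
have := right_door; rewrite -(is_door_evol t).
have := gap (i := L.-1); rewrite -(is_door_evol t) => /(_ ltac:(lia)).
case: L L_ge2 => [//|[//|l]] _ /=.
rewrite [c t.+2 _]step => nd d d'.
have : c t.+1 l.+2 <> sP.
  by rewrite step; case: (c t l.+1) nd; case: (c t l.+2); case: (c t l.+3) d.
by case: (c t.+1 l.+3) d'; case: (c t.+1 l.+1); case: (c t.+1 l.+2).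
Qed.

(** The way from cell 1 to a keymaster on [L] takes [L.-1] steps, and the way back as many. *)
Lemma pacman_path (t i : nat) : 0 < t -> i < L.-1 ->
  c (t + (L + L).-2) 1 = sK -> c (t + i) i.+1 = sP.
Proof.
move=> t0 iL K1.
have : c (t + L.-1) L = sK.
  have := @keymaster_origin (t + L.-1) L.-1; rewrite prednK; last exact: ltnW.
  by apply; [lia | rewrite -K1; congr (c _ _); lia].
have -> : t + L.-1 = (t + L.-1).-2.+2 by lia.
move=> /pacman_before_keymaster.
have -> : (t + L.-1).-2.+1 = t + L.-2 by lia.
have -> : L.-1 = L.-2.+1 by lia.
by move=> /pacman_origin; apply; lia.
Qed.

(* Hence no second pacman can start from cell [1] before the first one has
   crossed the gap. *)
Lemma no_ghost_behind (t d : nat) :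
  (forall i, i <= d -> c (t + i) i.+1 = sP) ->
  forall i, i <= d -> forall j, 0 < j <= i.+1 -> c (t + i) j != sG.
Proof.
move=> path; elim=> [|i IH] id j ji.
  have -> : j = 1 by lia.
  by rewrite (path 0).
have [->|ne] := eqVneq j i.+2; first by rewrite path.
case: j ji ne => [//|j] ji ne; rewrite addnS step.
have := IH (ltnW id) j.+2; have Pi := path i (ltnW id).
have [-> _|ne' /(_ ltac:(lia))] := eqVneq j i.
  by rewrite Pi; case: (c _ i); case: (c _ i.+2).
have : ~~ is_door (c (t + i) j.+2).
  by rewrite is_door_evol -(is_door_evol (t + j.+1)) path //; lia.
by case: (c _ j.+2); case: (c _ j); case: (c _ j.+1).
Qed.

Lemma keymaster_separation (s t : nat) : L + L <= s -> s < t ->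
  c s 1 = sK -> c t 1 = sK -> s + L <= t.
Proof.
move=> Ls st Ks Kt; rewrite leqNgt; apply/negP => tL.
(* The two pacmen start in cell 1 at times [u] and [u + e + 1]. At time [u + e] the first is still
   crossing, and [no_ghost_behind] bars the ghost in cell 1 or 2 that the second needs. *)
pose u := s - (L + L).-2; have u0 : 0 < u by lia.
pose e := (t - s).-1.
have path i : i <= e -> c (u + i) i.+1 = sP.
  move=> ie; apply: pacman_path => //; first lia.
  by rewrite -Ks; congr (c _ _); lia.
have : c (u + e).+1 1 = sP.
  have := @pacman_path (u + e).+1 0; rewrite addn0; apply => //; first lia.
  by rewrite -Kt; congr (c _ _); lia.
have := no_ghost_behind path (leqnn e); have := path e (leqnn e).
have := left_door (u + e); rewrite step.
case: (posnP e) => [e0|e0] + Pe noG.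
  by move: Pe; rewrite e0 => ->; case: (c _ 0); case: (c _ 2).
move: (noG 1) (noG 2) => /(_ isT) + /(_ ltac:(lia)).
by case: (c _ 0); case: (c _ 1); case: (c _ 2).
Qed.

End Gap.
End HalfLine.

(** * Counting busy times *)

Lemma sum_window (s B N : nat) : \sum_(t < N) (s < t <= s + B) <= B.
Proof.
suff -> : \sum_(t < N) (s < t <= s + B) = minn (N - s.+1) B by apply: geq_minr.
by elim: N => [|N IH]; rewrite ?big_ord0 ?big_ord_recr /= ?IH; lia.
Qed.

(** Induction strips off windows of length [L], each with at most one hit. [L * T] pays for the
    times before [T], the extra [L] for an incomplete window. *)
Lemma separated_count (D : pred nat) (T L : nat) :
  0 < L -> (forall s t, T <= s -> s < t -> D s -> D t -> s + L <= t) ->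
  forall N, L * \sum_(t < N) D t <= L * T + L + N.
Proof.
move=> L0 sep.
have count_le N : \sum_(t < N) D t <= N.
  elim: N => [|N IH]; rewrite ?big_ord0 // big_ord_recr /=.
  by rewrite -addn1; apply: leq_add => //; case: (D N).
have window M l : T <= M -> l <= L ->
    \sum_(t < M + l) D t <= \sum_(t < M) D t + 1.
  move=> TM lL.
  have [[s /andP[Ms sl] Ds]|noD] := pselect (exists2 s, M <= s < M + l & D s).
    have before k : M <= k <= s -> \sum_(t < k) D t = \sum_(t < M) D t.
      elim: k => [|k IH]; first by rewrite leqn0 => /andP[/eqP ->].
      rewrite leq_eqVlt => /andP[/orP[/eqP -> //|Mk ks]].
      rewrite big_ord_recr /= IH; last lia.
      case Dk: (D k); last by rewrite addn0.
      by have := sep k s (leq_trans TM Mk) ks Dk Ds; lia.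
    have after k : s < k <= M + l -> \sum_(t < k) D t = \sum_(t < M) D t + 1.
      elim: k => [//|k IH] /andP[].
      rewrite ltnS leq_eqVlt => /orP[/eqP <- _|sk kl].
        by rewrite big_ord_recr /= Ds before // Ms leqnn.
      rewrite big_ord_recr /= IH; last lia.
      case Dk: (D k); last by rewrite addn0.
      by have := sep s k (leq_trans TM Ms) sk Ds Dk; lia.
    by rewrite after // sl leqnn.
  elim: l lL noD => [|l IH] lL noD; first by rewrite addn0; lia.
  rewrite addnS big_ord_recr /=; case Dl: (D (M + l)).
    by case: noD; exists (M + l) => //; lia.
  rewrite addn0; apply: IH; first lia.
  by move=> [s sl Ds]; apply: noD; exists s => //; lia.
elim/ltn_ind => N IH; have [NT|TN] := leqP N T.
  by have := leq_mul (leqnn L) (count_le N); have := leq_mul (leqnn L) NT; lia.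
have [NTL|TLN] := leqP N (T + L).
  have := window T (N - T) (leqnn T); rewrite subnKC; last lia.
  move=> /(_ ltac:(lia)) /(leq_mul (leqnn L)).
  by have := leq_mul (leqnn L) (count_le T); lia.
have := window (N - L) L; rewrite subnK; last lia.
move=> /(_ ltac:(lia)) /(_ (leqnn L)) /(leq_mul (leqnn L)).
by have := IH (N - L) ltac:(lia); lia.
Qed.

Section Occupancy.
Variables (c : nat -> nat -> symbol) (n L : nat).
Hypothesis left_door : forall t, is_door (c t 0).
Hypothesis step :
  forall t i, c t.+1 i.+1 = pacman_rule (c t i) (c t i.+1) (c t i.+2).
Hypotheses (n_gt0 : 0 < n) (L_ge2 : 1 < L).
Hypothesis middle_door : is_door (c 0 n).
Hypothesis gap : forall i, 0 < i <= L -> ~~ is_door (c 0 (n + i)).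
Hypothesis right_door : is_door (c 0 (n + L.+1)).

Definition busy (t : nat) : bool :=
  [exists p : 'I_n, (0 < p) && occupied (c t p)].

Let middle_evol t : is_door (c t n).
Proof. by rewrite is_door_evol. Qed.

Let entry_keymaster t : c t.+1 n = sD -> c t n.+1 = sK.
Proof.
have := gap (i := 1); rewrite addn1 -(is_door_evol left_door step t).
move=> /(_ ltac:(lia)).
have := middle_evol t; case: n n_gt0 => [//|k] _ /=; rewrite step.
by case: (c t k.+1); case: (c t k); case: (c t k.+2).
Qed.

(** The door shows the keymaster one step after cell [n.+1], hence the successor in the
    threshold. *)
Lemma entry_separation (s t : nat) :
  (L + L).+1 <= s -> s < t -> c s n == sD -> c t n == sD -> s + L <= t.
Proof.
case: s t => [//|s] [//|t] Ls st.
move=> /eqP/entry_keymaster Ks /eqP/entry_keymaster Kt.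
have := @keymaster_separation (fun t i => c t (n + i)) _ _ L L_ge2 _ _ s t.
rewrite !addn1 addn0; apply=> //.
- by move=> u i; rewrite !addnS step.
Qed.

Lemma busy_count (N : nat) : L * \sum_(t < N) busy t <=
  L * drain_time n + drain_time n * (L * (L + L).+1 + L + N).
Proof.
set B := drain_time n.
have := separated_count (D := fun t => c t n == sD) (ltnW L_ge2)
  entry_separation N.
set S := \sum_(t < N) _ => LS.
suff : \sum_(t < N) busy t <= B + B * S.
  move=> le; apply: (leq_trans (leq_mul (leqnn L) le)).
  by rewrite mulnDr leq_add2l mulnCA leq_mul2l LS orbT.
have -> : B * S = \sum_(s < N) B * (c s n == sD).
  by rewrite big_distrr.
apply: (@leq_trans (\sum_(t < N) (t < B) +
    \sum_(t < N) \sum_(s < N) ((s < t <= s + B) * (c s n == sD)))).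
  rewrite -big_split /=; apply: leq_sum => t _.
  case: (boolP (busy t)) => [/existsP[p /andP[p0 occ]]|//].
  have [//|Bt] := ltnP t B.
  have pn : 0 < p < n by rewrite p0 /=.
  have [s st /eqP cs] := drain left_door step middle_door pn Bt occ.
  have sN : s < N by have := ltn_ord t; lia.
  by rewrite (bigD1 (Ordinal sN)) //= st cs.
apply: leq_add.
  have -> : \sum_(t < N) (t < B) = minn N B.
    by elim: (N) => [|k IH]; rewrite ?big_ord0 ?big_ord_recr /= ?IH; lia.
  exact: geq_minr.
rewrite exchange_big /=; apply: leq_sum => s _.
by rewrite -big_distrl /= leq_mul2r sum_window orbT.
Qed.

End Occupancy.

Local Open Scope classical_set_scope.
Local Open Scope ring_scope.

(** * Mean equicontinuity as a countable intersection of open conditions *)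

Section LimnEsup.
Variable R : realType.

Lemma limn_esup_le (u : nat -> R) (e : R) (N : nat) :
  (forall n, (N <= n)%N -> u n <= e) ->
  (limn_esup (fun n => (u n)%:E) <= e%:E)%E.
Proof.
move=> ue.
apply: (@le_trans _ _ (ereal_sup [set (u n)%:E | n in [set n | (N <= n)%N]])).
  apply: ereal_inf_lbound; exists [set n | (N <= n)%N] => //.
  exact: nbhs_infty_ge.
by apply: ge_ereal_sup => _ [n /= Nn <-]; rewrite lee_fin ue.
Qed.

Lemma limn_esup_lt (u : nat -> R) (e : R) :
  (limn_esup (fun n => (u n)%:E) < e%:E)%E ->
  exists N, forall n, (N <= n)%N -> u n < e.
Proof.
move=> /ereal_inf_lt[_ [V [N _ NV] <-]] supV; exists N => n Nn.
rewrite -lte_fin; apply: le_lt_trans supV.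
by apply: ereal_sup_ubound; exists n => //; exact: NV.
Qed.

End LimnEsup.

Section MeanEquicontinuity.
Variables (R : realType) (X : metricType R) (T : X -> X).

(* Two-variable form of mean equicontinuity up to [eps]; in contrast with the
   one-variable form, it is an open condition on [x]. *)
Definition mean_stable (eps : R) (x : X) : Prop :=
  exists2 delta : R, 0 < delta & forall y z : X,
    ball x delta y -> ball x delta z ->
    exists N, forall n, (N <= n)%N -> mean_dist T y z n <= eps.

Lemma mean_dist_triangle (x y z : X) (n : nat) :
  mean_dist T y z n <= mean_dist T x y n + mean_dist T x z n.
Proof.
rewrite /mean_dist -mulrDr ler_wpM2l ?invr_ge0 ?ler0n// -big_split /=.
by apply: ler_sum => i _; rewrite (metric_sym (iter i T x)) metric_triangle.
Qed.

Lemma open_mean_stable (eps : R) : open [set x | mean_stable eps x].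
Proof.
rewrite openE => x [d d0 dP]; apply/nbhs_ballP; exists (d / 2) => /=.
  by rewrite divr_gt0.
move=> y xy; exists (d / 2); first by rewrite divr_gt0.
have half z : ball y (d / 2) z -> ball x d z.
  by move=> yz; rewrite [d]splitr; apply: ball_triangle yz.
by move=> z w /half xz /half xw; exact: dP.
Qed.

Lemma mean_equicontinuity_pointP (x : X) :
  mean_equicontinuity_point T x <-> forall k : nat, mean_stable k.+1%:R^-1 x.
Proof.
split=> [eqx k|stx eps eps0].
  have : 0 < k.+1%:R^-1 :> R by rewrite invr_gt0.
  set e := _^-1 => e0; have e4 : 0 < e / 4 by lra.
  have [d d0 dP] := eqx _ e4.
  exists d => // y z; rewrite !ballEmdist /= => /dP ey /dP ez.
  have lt w : (limn_esup (fun n => (mean_dist T x w n)%:E) <= (e / 4)%:E)%E ->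
      exists N, forall n, (N <= n)%N -> mean_dist T x w n < e / 2.
    move=> le; apply: limn_esup_lt; apply: (le_lt_trans le).
    by rewrite lte_fin; lra.
  have [[N NP] [M MP]] := (lt _ ey, lt _ ez).
  exists (maxn N M) => n; rewrite geq_max => /andP[/NP xy /MP xz].
  have := mean_dist_triangle x y z n; lra.
have [k ke] : exists k : nat, k.+1%:R^-1 < eps.
  have [k _ kP] := near_infty_natSinv_lt (PosNum eps0).
  by exists k; exact: (kP k (leqnn _)).
have [d d0 dP] := stx k; exists d => // y xy.
have [|N NP] := dP x y (ballxx _ d0); first by rewrite ballEmdist.
apply: (@limn_esup_le _ _ _ N) => n /NP /le_trans; apply; exact: ltW.
Qed.

Lemma almost_mean_equicontinuousP :
  (forall eps : R, 0 < eps -> dense [set x | mean_stable eps x]) ->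
  almost_mean_equicontinuous T.
Proof.
move=> dn; exists (fun k : nat => [set x | mean_stable k.+1%:R^-1 x]); split.
  by move=> k; split; [exact: open_mean_stable|apply: dn; rewrite invr_gt0].
apply/seteqP; split => x /=.
  by move=> /mean_equicontinuity_pointP st k _; exact: st.
by move=> st; apply/mean_equicontinuity_pointP => k; exact: st.
Qed.

End MeanEquicontinuity.

(** * Cylinders and the Baire property of the full shift *)

Section Config.
Variable R : realType.
Implicit Types x y z : config R.

Lemma exp2_lt (eps : R) : 0 < eps -> exists m : nat, 2 ^- m < eps.
Proof.
move=> e0; have [m _ mP] := near_infty_natSinv_lt (PosNum e0).
exists m; apply: le_lt_trans (mP m (leqnn _)).
by rewrite lef_pV2 ?posrE// -natrX ler_nat ltn_expl.
Qed.

Lemma cylinder_ball (x : config R) (d : R) : 0 < d -> exists m : nat,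
  forall y, (forall j : int, (`|j| <= m)%N -> x j = y j) -> ball x d y.
Proof.
move=> /exp2_lt[m md]; exists m => y xy; rewrite ballEmdist /=.
by apply: lt_trans md; apply/config_dist_ltP.
Qed.

Lemma cylinder_open (A : set (config R)) x : open A -> A x -> exists m : nat,
  forall y, (forall j : int, (`|j| <= m)%N -> x j = y j) -> A y.
Proof.
rewrite openE => oA /oA /nbhs_ballP[d /= d0 dA].
by have [m mP] := cylinder_ball x d0; exists m => y /mP/dA.
Qed.

Lemma ball_cylinder x y (m : nat) :
  ball x (2 ^- m) y <-> forall j : int, (`|j| <= m)%N -> x j = y j.
Proof. by rewrite ballEmdist; exact: config_dist_ltP. Qed.

Lemma config_dist_le1 x y : mdist x y <= 1.
Proof.
change (config_dist x y <= 1); rewrite /config_dist; case: pselect => // xy.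
by rewrite invf_le1 ?exprn_gt0// exprn_ege1// ler1n.
Qed.

(** This makes the empty set non-residual. Each stage fixes a larger central block forcing
    membership in the next [F n]. *)
Lemma config_baire (F : nat -> set (config R)) :
  (forall n, open (F n) /\ dense (F n)) -> \bigcap_n F n !=set0.
Proof.
move=> FP.
have next (n : nat) (xm : config R * nat) : exists ym : config R * nat,
    [/\ (xm.2 < ym.2)%N, (forall j : int, (`|j| <= xm.2)%N -> xm.1 j = ym.1 j) &
     forall z, (forall j : int, (`|j| <= ym.2)%N -> ym.1 j = z j) -> F n z].
  have [oF dF] := FP n.
  have [||y [xy Fy]] := dF (ball xm.1 (2 ^- xm.2))°.
  - by exists xm.1; apply: nbhsx_ballx; rewrite invr_gt0 exprn_gt0.
  - exact: open_interior.
  have {xy} /ball_cylinder xy := interior_subset xy.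
  have [m mP] := cylinder_open oF Fy.
  exists (y, maxn m xm.2.+1); split => //=; first by rewrite leq_max leqnn orbT.
  by move=> z yz; apply: mP => j jm; apply: yz; rewrite leq_max jm.
have [g gP] := boolp.choice (fun p : nat * (config R * nat) => next p.1 p.2).
pose s := fix s n : config R * nat :=
  if n is k.+1 then g (k, s k) else (fun=> s0, 0%N).
have sP n : [/\ ((s n).2 < (s n.+1).2)%N,
    forall j : int, (`|j| <= (s n).2)%N -> (s n).1 j = (s n.+1).1 j &
    forall z, (forall j : int, (`|j| <= (s n.+1).2)%N -> (s n.+1).1 j = z j) ->
      F n z] := gP (n, s n).
have s_ge n : (n <= (s n).2)%N.
  by elim: n => // n IH; have [lt _ _] := sP n; exact: leq_ltn_trans IH lt.
have s_mono n k : ((s n).2 <= (s (n + k)%N).2)%N.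
  elim: k => [|k IH]; first by rewrite addn0.
  rewrite addnS; have [lt _ _] := sP (n + k)%N.
  exact: leq_trans IH (ltnW lt).
have s_agree n k (j : int) :
    (`|j| <= (s n).2)%N -> (s n).1 j = (s (n + k)%N).1 j.
  move=> jn; elim: k => [|k IH]; first by rewrite addn0.
  rewrite IH addnS; have [_ agree _] := sP (n + k)%N; apply: agree.
  exact: leq_trans jn (s_mono n k).
(* Stage [n] has radius at least [n], so coordinate [j] is settled at stage [|j|]. *)
exists (fun j => (s `|j|%N).1 j) => n _.
have [_ _] := sP n; apply => j jn.
have [nj|jn'] := leqP n.+1 `|j|%N.
  by rewrite -(subnKC nj) -s_agree.
by rewrite -(subnKC (ltnW jn')) -s_agree// subnKC.
Qed.

End Config.

Lemma unoccupied_inj (s s' : symbol) :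
  ~~ occupied s -> ~~ occupied s' -> is_door s = is_door s' -> s = s'.
Proof. by case: s; case: s'. Qed.

(** * Stability in the mean and absence of equicontinuity for Pacman *)

Section Cells.
Variable R : realType.
Implicit Types x y z : config R.

(* The half-line starting at the cell [-(m + 1)]. *)
Definition cells x (m t i : nat) : symbol :=
  iter t (@pacman R) x (i%:Z - m.+1%:Z).

Lemma cells_step x (m t i : nat) :
  cells x m t.+1 i.+1 =
  pacman_rule (cells x m t i) (cells x m t i.+1) (cells x m t i.+2).
Proof.
by rewrite /cells iterS /pacman; congr pacman_rule; congr (iter _ _ _ _); lia.
Qed.

Lemma is_door_iter x (t : nat) (j : int) :
  is_door (iter t (@pacman R) x j) = is_door (x j).
Proof. by elim: t => // t IH; rewrite iterS /pacman is_door_rule. Qed.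

Lemma iter_cells x (m t : nat) (j : int) : (`|j| <= m)%N ->
  iter t (@pacman R) x j = cells x m t `|(j + m.+1%:Z)%R|%N.
Proof. by move=> jm; rewrite /cells; congr (iter _ _ _ _); lia. Qed.

(** Empty windows with the same doors coincide; at a busy time the bound 1 on the metric
    suffices. *)
Lemma mdist_iter_le y z (m t : nat) :
  (forall j : int, (`|j| <= m)%N -> y j = z j) ->
  mdist (iter t (@pacman R) y) (iter t (@pacman R) z) <=
  2 ^- m + ((busy (cells y m) m.*2.+2 t)%:R + (busy (cells z m) m.*2.+2 t)%:R).
Proof.
move=> yz.
have le1 := config_dist_le1 (iter t (@pacman R) y) (iter t (@pacman R) z).
have p0 : 0 < 2 ^- m :> R by rewrite invr_gt0 exprn_gt0.
have [by1|by0] := boolP (busy (cells y m) _ t).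
  by apply: (le_trans le1); case: busy => /=; lra.
have [bz1|bz0] := boolP (busy (cells z m) _ t).
  by apply: (le_trans le1) => /=; lra.
rewrite !addr0; apply/ltW/config_dist_ltP => j jm.
have jn : (`|(j + m.+1%:Z)%R| < m.*2.+2)%N by lia.
have j0 : (0 < `|(j + m.+1%:Z)%R|)%N by lia.
apply: unoccupied_inj; last by rewrite !is_door_iter yz.
- rewrite (iter_cells _ _ jm); apply: contra by0 => occ.
  by apply/existsP; exists (Ordinal jn); rewrite j0.
- rewrite (iter_cells _ _ jm); apply: contra bz0 => occ.
  by apply/existsP; exists (Ordinal jn); rewrite j0.
Qed.

Lemma le_mean_of_count (eps l b k s N : R) : 0 < N -> 1 <= l -> 0 <= k ->
  8 * b <= eps * l -> 8 * k <= eps * N -> l * s <= k + b * N ->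
  s <= eps / 4 * N.
Proof.
move=> N0 l1 k0 bl kN ls; have l0 : 0 < l by lra.
rewrite -(ler_pM2l l0); apply: (le_trans ls).
have : 0 <= N * (eps * l - 8 * b) by rewrite mulr_ge0 ?subr_ge0// ltW.
have : 0 <= (l - 1) * k by rewrite mulr_ge0// subr_ge0.
have : 0 <= l * (eps * N - 8 * k) by rewrite mulr_ge0 ?subr_ge0// ltW.
lra.
Qed.

(* The cylinder consists of a window enclosed by doors and followed by a gap of
   length [L] and a further door.  Keymasters leave the gap at least [L] steps
   apart, so the window is empty most of the time when [L] is large. *)
Lemma dense_mean_stable (eps : R) : 0 < eps ->
  dense [set x : config R | mean_stable (@pacman R) eps x].
Proof.
move=> eps0 O [x Ox] oO; have [m0 m0P] := cylinder_open oO Ox.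
have [m1 m1P] := exp2_lt (divr_gt0 eps0 (ltr0n R 4)).
pose m := maxn m0 m1; pose n := m.*2.+2; pose B := drain_time n.
have mP : 2 ^- m <= eps / 4.
  apply: le_trans (ltW m1P); rewrite lef_pV2 ?posrE ?exprn_gt0//.
  by rewrite ler_eXn2l ?ltr1n// leq_maxr.
have archi (k : nat) :
    exists N0, forall N, (N0 <= N)%N -> 8 * k%:R <= eps * N%:R.
  exists (Num.truncn (8 * k%:R / eps)).+1 => N kN.
  rewrite [leRHS]mulrC -ler_pdivrMr//.
  by apply: (le_trans (ltW (truncnS_gt _))); rewrite ler_nat.
(* [L] brings the busy frequency [B / L] down to [eps / 8], leaving as much for the constant [K],
   which large [N] absorbs. *)
have [L1 BL1] := archi B; pose L := maxn 2 L1.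
have L2 : (1 < L)%N by rewrite leq_max.
have BL : 8 * B%:R <= eps * L%:R by apply: BL1; rewrite leq_maxr.
pose w : config R := fun j => if (`|j| <= m)%N then x j else
  if j \in [:: - m.+1%:Z; m.+1%:Z; (m + L).+2%:Z] then s1 else s0.
exists w; split; first by apply: m0P => j jm; rewrite /w leq_max jm.
exists (2 ^- (m + L).+2); first by rewrite invr_gt0 exprn_gt0.
pose K := (L * B + B * (L * (L + L).+1 + L))%N.
have count y N : ball w (2 ^- (m + L).+2) y ->
    (L * \sum_(t < N) busy (cells y m) n t <= K + B * N)%N.
  move=> /ball_cylinder wy.
  have left_door t : is_door (cells y m t 0).
    rewrite /cells is_door_iter -wy /w; last lia.
    rewrite ifF; last lia.
    by rewrite inE; case: eqP => //; lia.
  have cell0 i : (0 < i <= L.+1)%N ->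
      cells y m 0 (n + i) = if i == L.+1 then s1 else s0.
    move=> iL; rewrite /cells /= -wy /w; last lia.
    rewrite ifF; last lia.
    rewrite !inE; congr (if _ then _ else _); lia.
  have := @busy_count (cells y m) n L left_door (cells_step y m) isT L2 _ _ _ N.
  rewrite /K -/B => H.
  rewrite -addnA -mulnDr; apply: H.
  - rewrite /cells /= -wy /w; last lia.
    rewrite ifF; last lia.
    by rewrite !inE; case: eqP; [lia|case: eqP => //; lia].
  - by move=> i iL; rewrite cell0; [case: eqP => //; lia | lia].
  - by rewrite cell0 ?eqxx; last lia.
move=> y z wy wz; have [N0 N0P] := archi K; exists N0 => N /leqW/N0P NK.
have yz j : (`|j| <= m)%N -> y j = z j.
  move=> jm; move: wy wz => /ball_cylinder <-; last lia.
  by move=> /ball_cylinder <-; last lia.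
have sum_le v : ball w (2 ^- (m + L).+2) v ->
    (\sum_(t < N.+1) busy (cells v m) n t)%N%:R <= eps / 4 * N.+1%:R.
  move=> wv; apply: (@le_mean_of_count _ L%:R B%:R K%:R) => //.
    by rewrite ler1n; lia.
  by rewrite -!natrM -natrD ler_nat count.
rewrite /mean_dist mulrC ler_pdivrMr// big_mkord.
apply: (@le_trans _ _ (\sum_(t < N.+1) (2 ^- m +
    ((busy (cells y m) n t)%:R + (busy (cells z m) n t)%:R)))).
  by apply: ler_sum => t _; exact: mdist_iter_le.
rewrite big_split big_split /= sumr_const card_ord -!natr_sum.
have := sum_le _ wy; have := sum_le _ wz; rewrite /n.
have : 2 ^- m *+ N.+1 <= eps / 4 * N.+1%:R.
  by rewrite -[leLHS]mulr_natr ler_wpM2r.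
have : 0 < eps * N.+1%:R by rewrite mulr_gt0.
lra.
Qed.

Lemma pacman_no_equicontinuity_point x : ~ equicontinuity_point (@pacman R) x.
Proof.
move=> /(_ (2 ^- 0)) []; first by rewrite invr_gt0 exprn_gt0.
move=> d d0; have [m mP] := cylinder_ball x d0 => near_x.
pose n := m.*2.+2; pose B := drain_time n.
pose y k : config R := fun j => if (`|j| <= m)%N then x j else
  if j \in [:: - m.+1%:Z; m.+1%:Z] then s1 else
  if j == (m + k).+2%:Z then sK else s0.
(* Cell index [m.+1] is the origin. Distances stay below 1, so the origin evolves as it does for
   [x], whatever [k]. *)
have same k k' t : cells (y k) m t m.+1 = cells (y k') m t m.+1.
  have agree l : cells (y l) m t m.+1 = iter t (@pacman R) x 0.
    have : ball x d (y l) by apply: mP => j jm; rewrite /y jm.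
    move=> /near_x /(_ t) /config_dist_ltP /(_ 0 isT) ->.
    by rewrite /cells subrr.
  by rewrite !agree.
have door0 k t : is_door (cells (y k) m t 0).
  rewrite /cells is_door_iter /y ifF; last lia.
  by rewrite inE; case: eqP => //; lia.
have cell_n k : cells (y k) m 0 n = s1.
  rewrite /cells /= /y ifF; last lia.
  by rewrite !inE; case: eqP; [lia|case: eqP => //; lia].
have door_n k t : is_door (cells (y k) m t n).
  by rewrite (is_door_evol (door0 k) (cells_step _ _)) cell_n.
have outside k t i :
    cells (y k) m t (n + i.+1) = if (i + t == k)%N then sK else s0.
  elim: t i => [|t IH] i.
    rewrite /cells /= /y ifF; last lia.
    rewrite ifF; last first.
      rewrite !inE; apply/negP; lia.
    congr (if _ then _ else _); lia.
  rewrite addnS cells_step -!addnS !IH.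
  have -> : (i + t.+1 == k)%N = (i.+1 + t == k)%N by lia.
  case: i => [|i].
    rewrite addn0; have := door_n k t.
    by case: (cells _ _ _ _); case: eqP; case: eqP => //; lia.
  rewrite IH; case: eqP; case: eqP; case: eqP => //; lia.
have entry k t : cells (y k) m t n = sD -> t = k.+1.
  case: t => [|t]; first by rewrite cell_n.
  have := door_n k t; have := outside k t 0%N.
  rewrite cells_step addn1 add0n => ->.
  by case: (cells _ _ _ _); case: (cells _ _ _ _); case: eqP => // ->.
have entered k : cells (y k) m k.+1 n = sD.
  have := door_n k k; have := outside k k 0%N.
  rewrite cells_step addn1 add0n eqxx => ->.
  by case: (cells _ _ _ n); case: (cells _ _ _ _).
(* By time [k.+1] the window of [y 0], entered only at time 1, is drained, so by [same] the origin
   is empty for [y k] too. *)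
pose k := B.+2.
have empty s : (k.+1 <= s)%N -> ~~ occupied (cells (y k) m s m.+1).
  move=> ks; rewrite (same _ 0%N); apply/negP => occ.
  have mn : (0 < m.+1 < n)%N by lia.
  have Bs : (B <= s)%N by lia.
  have [s' ss' /entry] :=
    drain (door0 _) (cells_step _ _) (door_n _ 0%N) mn Bs occ.
  lia.
have occ_n : occupied (cells (y k) m k.+1 n) by rewrite entered.
have mn : (m.+1 < n <= n)%N by lia.
(* Unable to pass the empty origin, what enters at time [k.+1] would keep the window occupied for
   over [B] steps, against [drain]. *)
have [q /andP[mq]] := survival (door0 k) (cells_step _ _) (ltn0Sn m)
  (door_n k 0%N) empty mn occ_n B.+1.
rewrite leq_eqVlt => /orP[/eqP ->|qn] occ.
  have := door_n k (k.+1 + B.+1)%N; have := entry k (k.+1 + B.+1)%N.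
  by case: (cells _ _ _ _) occ => // _ /(_ erefl); lia.
have q0 : (0 < q < n)%N by lia.
have Bk : (B <= k.+1 + B.+1)%N by lia.
have [s ss /entry] :=
  drain (door0 k) (cells_step _ _) (door_n _ 0%N) q0 Bk occ.
lia.
Qed.

End Cells.

Theorem theorem3p14 (R : realType) :
  (forall x : config R, ~ equicontinuity_point (@pacman R) x) /\
  ~ almost_equicontinuous (@pacman R) /\
  almost_mean_equicontinuous (@pacman R).
Proof.
split; first exact: pacman_no_equicontinuity_point.
split; last exact/almost_mean_equicontinuousP/dense_mean_stable.
move=> [F [/config_baire[x Fx]]] /seteqP[_ /(_ x Fx)].
exact: pacman_no_equicontinuity_point.
Qed.
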